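(* For every fixed integer $d$, there is an incremental-polynomial time algorithm solving ICS-Enum on acyclic implicational bases $(X,\Sigma)$ such that for every $x\in X$, every $M\in\mathrm{irr}(x)$ and every $y\in X\setminus M$, the hypergraph $\mathcal{H}_{M,y}$ has dual-dimension at most $d$.
   Context: An implicational base $(X,\Sigma)$ is a set of implications $A\to B$ with $A,B\subseteq X$ disjoint; its closed sets are the $C$ with $A\subseteq C\Rightarrow B\subseteq C$ for all $A\to B\in\Sigma$, forming a closure system $\mathcal{C}$; $\mathrm{irr}(x)$ is the family of inclusion-maximal closed sets not containing $x$ and $\mathrm{irr}(\mathcal{C})=\bigcup_x\mathrm{irr}(x)$. ICS-Enum: given $(X,\Sigma)$, list $\mathrm{irr}(\mathcal{C})$. $\Sigma$ is acyclic if the digraph on $X$ with arcs $ab$ ($a\in A,b\in B$, $A\to B\in\Sigma$) is acyclic. For $M\in\mathrm{irr}(x)$ and $y\in X\setminus M$, $\mathcal{H}_{M,y}$ is the hypergraph with edge set $\mathcal{E}_{M,y}=\{A: A\to B\in\Sigma,\ A\setminus M=\{y\},\ B\not\subseteq M\}$ on vertex set $\bigcup\mathcal{E}_{M,y}$. The dual-dimension of a hypergraph is the maximum size of an inclusion-minimal set meeting all its edges. Incremental-polynomial time: the $i$-th output (and termination) occurs within time polynomial in $|X|+|\Sigma|$ plus $i$. *)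

(* Defs.v *)
From HB Require Import structures.
From mathcomp Require Import all_boot all_order all_algebra.

Set Implicit Arguments.
Unset Strict Implicit.
Unset Printing Implicit Defensive.

Import Order.TTheory GRing.Theory Num.Theory.

(* The pair (A, B) is the implication A -> B. *)
Notation implication X := ({set X} * {set X})%type.

Section ImplicationalBases.
Variable X : finType.

Definition implicational_base (Sigma : {set implication X}) : Prop :=
  forall A B : {set X}, (A, B) \in Sigma -> [disjoint A & B].

Definition closed_set (Sigma : {set implication X}) (C : {set X}) : bool :=
  [forall imp in Sigma, (imp.1 \subset C) ==> (imp.2 \subset C)].

Definition irr (Sigma : {set implication X}) (x : X) : {set {set X}} :=
  [set M | maxset (fun C => closed_set Sigma C && (x \notin C)) M].

Definition irr_closed_sets (Sigma : {set implication X}) : {set {set X}} :=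
  \bigcup_(x : X) irr Sigma x.

Definition arc (Sigma : {set implication X}) : rel X :=
  fun a b => [exists imp in Sigma, (a \in imp.1) && (b \in imp.2)].

Definition acyclic_base (Sigma : {set implication X}) : Prop :=
  forall c : seq X, ucycle (arc Sigma) c -> c = [::].

Record hypergraph := Hypergraph {
  vertices : {set X};
  edges : {set {set X}}
}.

Definition hits_all_edges (H : hypergraph) (T : {set X}) : bool :=
  (T \subset vertices H) && [forall E in edges H, T :&: E != set0].

Definition minimal_transversals (H : hypergraph) : {set {set X}} :=
  [set T | minset (hits_all_edges H) T].

Definition dual_dimension (H : hypergraph) : nat :=
  \max_(T in minimal_transversals H) #|T|.

Definition premises_at (Sigma : {set implication X}) (M : {set X}) (y : X) :
    {set {set X}} :=
  [set A | [exists B, [&& (A, B) \in Sigma,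
                          A :\: M == [set y] & ~~ (B \subset M)]]].

Definition premise_hypergraph (Sigma : {set implication X}) (M : {set X})
    (y : X) : hypergraph :=
  Hypergraph (cover (premises_at Sigma M y)) (premises_at Sigma M y).

Definition dual_dimension_bounded (d : int) (Sigma : {set implication X}) :
    Prop :=
  forall (x : X) (M : {set X}) (y : X),
    M \in irr Sigma x -> y \notin M ->
    ((dual_dimension (premise_hypergraph Sigma M y))%:Z <= d)%R.

End ImplicationalBases.

(* Model of computation: the WHILE language over binary trees of N. D. Jones, *)
(* Computability and Complexity from a Programming Perspective, with its      *)
(* usual unit-cost measure, extended with an output instruction. The only     *)
(* test is whether a tree is Nil, and cons, hd and tl are constant-time       *)
(* pointer operations, so running times agree with those of Turing machines   *)
(* and RAMs up to a polynomial.                                               *)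
Inductive tree : Type := Nil | Cons of tree & tree.

Definition hd (v : tree) : tree := if v is Cons a _ then a else Nil.
Definition tl (v : tree) : tree := if v is Cons _ b then b else Nil.
Definition is_cons (v : tree) : bool := if v is Cons _ _ then true else false.

Fixpoint tree_size (v : tree) : nat :=
  if v is Cons a b then (tree_size a + tree_size b).+1 else 1.

Inductive expr : Type :=
| EVar of nat
| ENil
| ECons of expr & expr
| EHd of expr
| ETl of expr.

Inductive cmd : Type :=
| CSkip
| CAssign of nat & expr
| CSeq of cmd & cmd
| CIf of expr & cmd & cmd
| CWhile of expr & cmd
| COutput of expr.

Definition store := nat -> tree.

Definition update (s : store) (k : nat) (v : tree) : store :=
  fun j => if j == k then v else s j.

Fixpoint eval (s : store) (e : expr) : tree :=
  match e with
  | EVar k => s k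
  | ENil => Nil
  | ECons e1 e2 => Cons (eval s e1) (eval s e2)
  | EHd e1 => hd (eval s e1)
  | ETl e1 => tl (eval s e1)
  end.

Fixpoint expr_cost (e : expr) : nat :=
  match e with
  | EVar _ | ENil => 1
  | ECons e1 e2 => (expr_cost e1 + expr_cost e2).+1
  | EHd e1 | ETl e1 => (expr_cost e1).+1
  end.

(* The emitted trees, each with the time at which it was emitted. *)
Definition trace := seq (nat * tree).

Definition delay (t : nat) (o : trace) : trace :=
  [seq (t + q.1, q.2) | q <- o].

(* exec c s s' t o: started in store s, the command c halts in store s' after *)
(* exactly t time units, emitting o (times being counted from the start of c).*)
(* Emitting a tree is charged its full size.                                  *)
Inductive exec : cmd -> store -> store -> nat -> trace -> Prop :=
| ExecSkip s : exec CSkip s s 1 [::]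
| ExecAssign s k e :
    exec (CAssign k e) s (update s k (eval s e)) (expr_cost e).+1 [::]
| ExecSeq c1 c2 s s1 s2 t1 t2 o1 o2 :
    exec c1 s s1 t1 o1 -> exec c2 s1 s2 t2 o2 ->
    exec (CSeq c1 c2) s s2 (t1 + t2) (o1 ++ delay t1 o2)
| ExecIfTrue e c1 c2 s s1 t o :
    is_cons (eval s e) -> exec c1 s s1 t o ->
    exec (CIf e c1 c2) s s1 ((expr_cost e).+1 + t) (delay (expr_cost e).+1 o)
| ExecIfFalse e c1 c2 s s1 t o :
    ~~ is_cons (eval s e) -> exec c2 s s1 t o ->
    exec (CIf e c1 c2) s s1 ((expr_cost e).+1 + t) (delay (expr_cost e).+1 o)
| ExecWhileStop e c s :
    ~~ is_cons (eval s e) -> exec (CWhile e c) s s (expr_cost e).+1 [::]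
| ExecWhileLoop e c s s1 s2 t1 t2 o1 o2 :
    is_cons (eval s e) -> exec c s s1 t1 o1 -> exec (CWhile e c) s1 s2 t2 o2 ->
    exec (CWhile e c) s s2 ((expr_cost e).+1 + t1 + t2)
      (delay (expr_cost e).+1 o1 ++ delay ((expr_cost e).+1 + t1) o2)
| ExecOutput s e :
    let t := expr_cost e + tree_size (eval s e) in
    exec (COutput e) s s t [:: (t, eval s e)].

Definition initial_store (v : tree) : store := update (fun=> Nil) 0 v.

Definition encode_bool (b : bool) : tree := if b then Cons Nil Nil else Nil.

Definition encode_seq (s : seq tree) : tree := foldr Cons Nil s.

Section Encoding.
Variable X : finType.

(* xs is a listing of X; a subset is encoded by its characteristic vector.    *)
Definition encode_set (xs : seq X) (A : {set X}) : tree :=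
  encode_seq [seq encode_bool (x \in A) | x <- xs].

Definition encode_implication (xs : seq X) (imp : implication X) : tree :=
  Cons (encode_set xs imp.1) (encode_set xs imp.2).

Definition encode_base (xs : seq X) (sigma : seq (implication X)) : tree :=
  Cons (encode_set xs [set: X])
       (encode_seq [seq encode_implication xs imp | imp <- sigma]).

End Encoding.

(* The input may list X and Sigma in any order (without repetition), and the  *)
(* output is a listing of the irreducible closed sets without repetition. The *)
(* bounding polynomial depends only on the program.                           *)
Definition incremental_polynomial_ICS_enum (c : cmd)
    (class : forall X : finType, {set implication X} -> Prop) : Prop :=
  exists p : {poly nat},
  forall (X : finType) (Sigma : {set implication X})
         (xs : seq X) (sigma : seq (implication X)),
    implicational_base Sigma -> class X Sigma ->
    perm_eq xs (enum X) -> perm_eq sigma (enum Sigma) ->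
    exists (s : store) (t : nat) (o : trace) (ms : seq {set X}),
      [/\ exec c (initial_store (encode_base xs sigma)) s t o,
          [seq q.2 | q <- o] = [seq encode_set xs M | M <- ms],
          perm_eq ms (enum (irr_closed_sets Sigma)),
          forall i : nat, i < size o ->
            (nth (0, Nil) o i).1 <= p.[(#|X| + #|Sigma| + i.+1)%N]%R
        & t <= p.[(#|X| + #|Sigma| + size o)%N]%R].

(* Main.v *)
Require Import Defs.
From HB Require Import structures.
From mathcomp Require Import all_boot all_order all_algebra zify.
Import Defs.

Set Implicit Arguments.
Unset Strict Implicit.
Unset Printing Implicit Defensive.

(* Let F be the family of irreducible closed sets found so far, and Ls the     *)
(* family F together with the empty set, X and the singletons. For S0, S1,     *)
(* T1, ..., Td, S in Ls, the closure of (S0 u S1) n T1 n ... n Td, when it     *)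
(* does not contain S, is extended greedily to an irreducible closed set. If   *)
(* no new set arises in this way, then F is complete: let Mx be in irr(x) and  *)
(* assume that F contains irr(t) for all strict ancestors t of x. For M in F   *)
(* and irr(x), distinct from Mx, let y be an element of Mx \ M that is as far  *)
(* downstream as possible. The complement of Mx meets all edges of H_{M,y},    *)
(* hence contains a minimal transversal T, of size at most d, and each t in T  *)
(* is a strict ancestor of x; pick Mt in irr(t) above Mx. Then the intersection*)
(* of M u {y} with the sets Mt is closed, and its extension M' avoiding x is   *)
(* in F with Mx \ M' strictly smaller than Mx \ M. Iterating reaches Mx.       *)
(*                                                                             *)
(* The search for a new set consists of for-loops over lists that it does not  *)
(* modify, of length linear in |X| + |Sigma| + |F|, nested to a depth that     *)
(* depends only on d.                                                          *)

(** * A total combinator language and its compilation *)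

(** A member of [irr x] that misses part of a target [Mx] can be moved towards [Mx] by a step of
    fixed shape, so trying all such steps decides whether the family found so far is complete.
    Acyclicity provides the orders behind this: [rank] grows strictly along arcs, and every element
    outside a member of [irr x] is an ancestor of [x] ([irr_ancestor]). [premise_transversal] turns
    the dual-dimension bound [D] into at most [D] strict ancestors of [x], outside [Mx], that hit
    every premise obstructing the addition of y to M. By [step_closed], cutting M with y added by
    sets that avoid these ancestors gives a closed set. [saturated_complete] combines the two by
    induction on the rank of [x] and, inside, on the size of Mx \ M.

    A step involves D + 3 sets from a list of linear length, and greedy extension makes its result
    irreducible ([extend_irr_closed]). Hence one pass over all steps either finds a new irreducible
    closed set or certifies completeness ([sem_pass]). Passes are written in a language whose only
    iteration is a fold over a fixed list; [compile_correct] bounds the running time of the compiled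
    code by [cost], which is polynomial by [polynomial_cost]. [exec_main_loop] charges one pass to
    each output. *)

Inductive global := GX | GSigma | GL | GF.

Definition reg (g : global) : nat :=
  match g with GX => 0 | GSigma => 1 | GL => 2 | GF => 3 end.

(** Programs are functions of a single tree, without variables. The only iteration is a fold over a
    global, so every program is total; its body receives [Cons a i] for the accumulator a and the
    current item i. *)
Inductive fn :=
| FId | FNil | FHd | FTl
| FGlob of global
| FComp of fn & fn
| FPair of fn & fn
| FIf of fn & fn & fn
| FFold of global & fn.

Fixpoint spine (v : tree) : seq tree :=
  if v is Cons a b then a :: spine b else [::].

Fixpoint sem (G : global -> tree) (f : fn) (v : tree) : tree :=
  match f with
  | FId => v
  | FNil => Nil
  | FHd => hd v
  | FTl => tl v
  | FGlob g => G g
  | FComp f1 f2 => sem G f2 (sem G f1 v)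
  | FPair f1 f2 => Cons (sem G f1 v) (sem G f2 v)
  | FIf c f1 f2 => if is_cons (sem G c v) then sem G f1 v else sem G f2 v
  | FFold g b => foldl (fun a i => sem G b (Cons a i)) v (spine (G g))
  end.

(** Register [k] holds the argument and receives the result. Registers above [k] are scratch and
    those below are preserved, so subprograms can run at [k.+1] or [k.+2] without disturbing their
    context. *)
Fixpoint compile (k : nat) (f : fn) : cmd :=
  match f with
  | FId => CSkip
  | FNil => CAssign k ENil
  | FHd => CAssign k (EHd (EVar k))
  | FTl => CAssign k (ETl (EVar k))
  | FGlob g => CAssign k (EVar (reg g))
  | FComp f1 f2 => CSeq (compile k f1) (compile k f2)
  | FPair f1 f2 =>
      CSeq (CAssign k.+1 (EVar k))
     (CSeq (compile k.+1 f1)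
     (CSeq (CAssign k.+2 (EVar k))
     (CSeq (compile k.+2 f2)
           (CAssign k (ECons (EVar k.+1) (EVar k.+2))))))
  | FIf c f1 f2 =>
      CSeq (CAssign k.+1 (EVar k))
     (CSeq (compile k.+1 c)
           (CIf (EVar k.+1) (compile k f1) (compile k f2)))
  | FFold g b =>
      CSeq (CAssign k.+1 (EVar (reg g)))
           (CWhile (EVar k.+1)
             (CSeq (CAssign k.+2 (ECons (EVar k) (EHd (EVar k.+1))))
             (CSeq (compile k.+2 b)
             (CSeq (CAssign k (EVar k.+2))
                   (CAssign k.+1 (ETl (EVar k.+1)))))))
  end.

(* The lists iterated over are the globals, which no compiled code modifies:  *)
(* their lengths, at most N.+2, bound the running time.                       *)
Fixpoint cost (f : fn) (N : nat) : nat :=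
  match f with
  | FId => 1
  | FNil | FGlob _ => 2
  | FHd | FTl => 3
  | FComp f1 f2 => cost f1 N + cost f2 N
  | FPair f1 f2 => 8 + cost f1 N + cost f2 N
  | FIf c f1 f2 => 4 + cost c N + cost f1 N + cost f2 N
  | FFold _ b => 4 + N.+2 * (12 + cost b N)
  end.

Lemma leq_cost f N N' : N <= N' -> cost f N <= cost f N'.
Proof.
move=> le_N; elim: f => //= [f1 IH1 f2 IH2|f1 IH1 f2 IH2|c IHc f1 IH1 f2 IH2|g b IHb];
  rewrite ?leq_add2l ?leq_mul ?leq_add //.
Qed.

Lemma update_same s k v : update s k v k = v.
Proof. by rewrite /update eqxx. Qed.

Lemma update_other s k v j : j != k -> update s k v j = s j.
Proof. by rewrite /update => /negbTE->. Qed.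

Lemma reg_lt g : reg g < 4.
Proof. by case: g. Qed.

(** * Correctness and running time of compiled code *)

Section Compile.
Variables (G : global -> tree) (N : nat).
Hypothesis size_G : forall g, size (spine (G g)) <= N.+2.

Definition computes (f : fn) : Prop := forall (k : nat) (s : store),
  4 <= k -> (forall g, s (reg g) = G g) ->
  exists s' t, [/\ exec (compile k f) s s' t [::], s' k = sem G f (s k),
    forall j, j < k -> s' j = s j & t <= cost f N].

Lemma exec_seq0 c1 c2 s s1 s2 t1 t2 :
  exec c1 s s1 t1 [::] -> exec c2 s1 s2 t2 [::] ->
  exec (CSeq c1 c2) s s2 (t1 + t2) [::].
Proof. exact: ExecSeq. Qed.

Lemma computes_assign f :
  (forall k, exists2 e, compile k f = CAssign k e & (expr_cost e).+1 <= cost f N /\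
     forall s, (forall g, s (reg g) = G g) -> eval s e = sem G f (s k)) ->
  computes f.
Proof.
move=> fE k s k4 sG; have [e -> [le_e eE]] := fE k.
exists (update s k (eval s e)), (expr_cost e).+1; split=> //.
- exact: ExecAssign.
- by rewrite update_same eE.
- by move=> j jk; rewrite update_other // ltn_eqF.
Qed.

(** The loop consumes register [k.+1], so the induction is on its content [src] rather than on the
    global it was copied from. The body runs at [k.+2] and therefore leaves this register intact. *)
Lemma compile_loop k b (src : tree) (s : store) :
  4 <= k -> computes b -> (forall g, s (reg g) = G g) -> s k.+1 = src ->
  exists s' t, [/\ exec (CWhile (EVar k.+1)
             (CSeq (CAssign k.+2 (ECons (EVar k) (EHd (EVar k.+1))))
             (CSeq (compile k.+2 b)
             (CSeq (CAssign k (EVar k.+2))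
                   (CAssign k.+1 (ETl (EVar k.+1))))))) s s' t [::],
    s' k = foldl (fun a i => sem G b (Cons a i)) (s k) (spine src),
    forall j, j < k -> s' j = s j &
    t <= 2 + size (spine src) * (12 + cost b N)].
Proof.
move=> k4 cb; elim: src s => [|a _ rest IH] s sG sk.
  by exists s, 2; split=> //; apply: (@ExecWhileStop (EVar k.+1)); rewrite /= sk.
set s1 := update s k.+2 (Cons (s k) a).
have rk g : reg g < k := leq_trans (reg_lt g) k4.
have s1G g : s1 (reg g) = G g.
  by rewrite /s1 update_other // ltn_eqF //; apply: leq_trans (rk g) _; lia.
have [|s2 [t2 [ex2 s2k s2j t2le]]] := cb k.+2 s1 _ s1G; first lia.
set s3 := update s2 k (s2 k.+2); set s4 := update s3 k.+1 rest.
have s4j j : j < k -> s4 j = s j.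
  move=> jk; rewrite /s4 /s3 !update_other ?s2j /s1 ?update_other //; lia.
have s4G g : s4 (reg g) = G g by rewrite s4j.
have [|s' [t' [ex' s'k s'j t'le]]] := IH s4 s4G; first exact: update_same.
(* In order: the loop test, forming the pair, the body, copying back the accumulator, advancing the
   list. Without the body this adds up to the 12 in the bound. *)
exists s', (2 + (5 + (t2 + (2 + 3))) + t'); split.
- refine (@ExecWhileLoop (EVar k.+1) _ s s4 s' _ t' [::] [::] _ _ ex').
    by rewrite /= sk.
  apply: (exec_seq0 (s1 := s1)).
    by have := ExecAssign s k.+2 (ECons (EVar k) (EHd (EVar k.+1))); rewrite /= sk.
  apply: (exec_seq0 ex2); apply: (exec_seq0 (s1 := s3)).
    exact: (ExecAssign s2 k (EVar k.+2)).
  have s3k : s3 k.+1 = Cons a rest.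
    by rewrite /s3 update_other ?s2j ?/s1 ?update_other //; lia.
  by have := ExecAssign s3 k.+1 (ETl (EVar k.+1)); rewrite /= s3k.
- rewrite s'k /= /s4 update_other; last lia.
  by rewrite /s3 update_same s2k /s1 update_same.
- by move=> j jk; rewrite s'j ?s4j.
- rewrite /=; lia.
Qed.

Lemma compile_correct f : computes f.
Proof.
elim: f => [|||| g | f1 IH1 f2 IH2 | f1 IH1 f2 IH2 | c IHc f1 IH1 f2 IH2 | g b IHb].
- by move=> k s _ _; exists s, 1; split=> //; apply: ExecSkip.
- by apply: computes_assign => k; exists ENil.
- by apply: computes_assign => k; exists (EHd (EVar k)).
- by apply: computes_assign => k; exists (ETl (EVar k)).
- apply: computes_assign => k; exists (EVar (reg g)) => //.
  by split=> [|s sG] /=; rewrite ?sG.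
- move=> k s k4 sG.
  have rk g : reg g < k := leq_trans (reg_lt g) k4.
  have [s1 [t1 [ex1 s1k s1j t1le]]] := IH1 k s k4 sG.
  have [|s2 [t2 [ex2 s2k s2j t2le]]] := IH2 k s1 k4; first by move=> g; rewrite s1j.
  exists s2, (t1 + t2); split; first exact: exec_seq0 ex1 ex2.
  + by rewrite s2k s1k.
  + by move=> j jk; rewrite s2j ?s1j.
  + by rewrite /= leq_add.
- move=> k s k4 sG; have rk g : reg g < k := leq_trans (reg_lt g) k4.
  set s0 := update s k.+1 (s k).
  have s0j j : j < k.+1 -> s0 j = s j by move=> jk; rewrite /s0 update_other //; lia.
  have [||s1 [t1 [ex1 s1k s1j t1le]]] := IH1 k.+1 s0; first lia.
    by move=> g; rewrite s0j ?sG ?(leq_trans (rk _)).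
  set s2 := update s1 k.+2 (s k).
  have s2j j : j < k.+1 -> s2 j = s j.
    by move=> jk; rewrite /s2 update_other ?s1j ?s0j //; lia.
  have [||s3 [t3 [ex3 s3k s3j t3le]]] := IH2 k.+2 s2; first lia.
    by move=> g; rewrite s2j ?sG ?(leq_trans (rk _)).
  exists (update s3 k (Cons (s3 k.+1) (s3 k.+2))), (2 + (t1 + (2 + (t3 + 4)))); split.
  + apply: (exec_seq0 (s1 := s0)); first exact: (ExecAssign s k.+1 (EVar k)).
    apply: (exec_seq0 ex1); apply: (exec_seq0 (s1 := s2)).
      by rewrite /s2 -(s0j k) // -(s1j k) //; exact: (ExecAssign s1 k.+2 (EVar k)).
    apply: (exec_seq0 ex3); exact: (ExecAssign s3 k (ECons (EVar k.+1) (EVar k.+2))).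
  + rewrite update_same s3k s3j // /s2 update_same update_other; last lia.
    by rewrite s1k /s0 update_same.
  + by move=> j jk; rewrite update_other ?s3j ?s2j //; lia.
  + rewrite /=; lia.
- move=> k s k4 sG; have rk g : reg g < k := leq_trans (reg_lt g) k4.
  set s0 := update s k.+1 (s k).
  have s0j j : j < k.+1 -> s0 j = s j by move=> jk; rewrite /s0 update_other //; lia.
  have [||s1 [t1 [ex1 s1k s1j t1le]]] := IHc k.+1 s0; first lia.
    by move=> g; rewrite s0j ?sG ?(leq_trans (rk _)).
  have s1j' j : j < k.+1 -> s1 j = s j by move=> jk; rewrite s1j ?s0j.
  have s1G g : s1 (reg g) = G g by rewrite s1j' ?sG ?(leq_trans (rk _)).
  rewrite /s0 update_same in s1k.
  have ex0 : exec (CAssign k.+1 (EVar k)) s s0 2 [::].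
    exact: (ExecAssign s k.+1 (EVar k)).
  have [s2 [t2 [ex2 s2k s2j t2le]]] := IH1 k s1 k4 s1G.
  have [s3 [t3 [ex3 s3k s3j t3le]]] := IH2 k s1 k4 s1G.
  case c_sk: (is_cons (sem G c (s k))).
  + exists s2, (2 + (t1 + (2 + t2))); split.
    * apply: (exec_seq0 ex0); apply: (exec_seq0 ex1).
      by apply: (ExecIfTrue (e := EVar k.+1)) ex2; rewrite /= s1k.
    * by rewrite /= c_sk s2k s1j'.
    * by move=> j jk; rewrite s2j ?s1j' // ltnW.
    * rewrite /=; lia.
  + exists s3, (2 + (t1 + (2 + t3))); split.
    * apply: (exec_seq0 ex0); apply: (exec_seq0 ex1).
      by apply: (ExecIfFalse (e := EVar k.+1)) ex3; rewrite /= s1k c_sk.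
    * by rewrite /= c_sk s3k s1j'.
    * by move=> j jk; rewrite s3j ?s1j' // ltnW.
    * rewrite /=; lia.
- move=> k s k4 sG; have rk g' : reg g' < k := leq_trans (reg_lt g') k4.
  set s0 := update s k.+1 (G g).
  have s0j j : j < k.+1 -> s0 j = s j by move=> jk; rewrite /s0 update_other //; lia.
  have [||s' [t [ex sk sj tle]]] := @compile_loop k b (G g) s0 k4 IHb.
    by move=> g'; rewrite s0j ?sG ?(leq_trans (rk _)).
    exact: update_same.
  exists s', (2 + t); split.
  + apply: (exec_seq0 (s1 := s0)) ex.
    by rewrite /s0 -(sG g); exact: (ExecAssign s k.+1 (EVar (reg g))).
  + by rewrite sk s0j.
  + by move=> j jk; rewrite sj ?s0j // ltnW.
  + have := leq_mul (size_G g) (leqnn (12 + cost b N)); rewrite /=; lia.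
Qed.

End Compile.

(** * Closures and irreducible closed sets *)

Section Closure.
Variables (X : finType) (Sigma : {set implication X}).
Variable sigma : seq (implication X).
Hypothesis sigmaP : perm_eq sigma (enum Sigma).

Definition fire (C : {set X}) (imp : implication X) : {set X} :=
  if imp.1 \subset C then C :|: imp.2 else C.

Definition round (C : {set X}) : {set X} := foldl fire C sigma.

Definition cl (C : {set X}) : {set X} := iter #|X| round C.

Definition grow (S C Z : {set X}) : {set X} :=
  if S \subset cl (C :|: Z) then C else cl (C :|: Z).

(** What has to be avoided is a set [S] and not an element, so that in the search it ranges over the
    same list as all other sets; the singletons in that list give the elements. *)
Definition extend (Ls : seq {set X}) (S C : {set X}) : {set X} :=
  foldl (grow S) C Ls.

Implicit Types (C S Z M : {set X}) (Ls : seq {set X}).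

Lemma mem_sigma imp : (imp \in sigma) = (imp \in Sigma).
Proof. by rewrite (perm_mem sigmaP) mem_enum. Qed.

Lemma closed_setP (C : {set X}) :
  reflect (forall A B, (A, B) \in Sigma -> A \subset C -> B \subset C)
          (closed_set Sigma C).
Proof.
apply: (iffP forall_inP) => [clC A B /clC /implyP //|clC [A B] /clC AB].
exact/implyP.
Qed.

Lemma sub_fire C imp : C \subset fire C imp.
Proof. by rewrite /fire; case: ifP => // _; apply: subsetUl. Qed.

Lemma sub_foldl_fire s C : C \subset foldl fire C s.
Proof.
by elim: s C => //= imp s IH C; apply: subset_trans (sub_fire C imp) (IH _).
Qed.

Lemma foldl_fire_closed (D : {set X}) s C : closed_set Sigma D -> {subset s <= Sigma} ->
  C \subset D -> foldl fire C s \subset D.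
Proof.
move=> /closed_setP clD; elim: s C => //= -[A B] s IH C sS CD.
apply: IH => [i si|]; first by apply: sS; rewrite inE si orbT.
rewrite /fire /=; case: ifP => // AC; rewrite subUset CD.
by apply: (clD A) (subset_trans AC CD); apply: sS; rewrite mem_head.
Qed.

(** Firing only enlarges the set, so if the last set of the pass lies in [C], all intermediate ones
    equal [C] and no implication had any effect. *)
Lemma foldl_fire_fix s C : foldl fire C s \subset C ->
  forall imp, imp \in s -> imp.1 \subset C -> imp.2 \subset C.
Proof.
elim: s => //= i s IH fC imp.
have fireC : fire C i = C.
  apply/eqP; rewrite eqEsubset sub_fire andbT.
  exact: subset_trans (sub_foldl_fire s _) fC.
rewrite fireC in fC; rewrite inE => /predU1P[-> iC|]; last exact: IH.
by rewrite -fireC /fire iC subsetUr.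
Qed.

Lemma sub_round C : C \subset round C. Proof. exact: sub_foldl_fire. Qed.

Lemma sub_cl C : C \subset cl C.
Proof.
rewrite /cl; elim: #|X| => //= n IH; exact: subset_trans IH (sub_round _).
Qed.

Lemma cl_min C (D : {set X}) : closed_set Sigma D -> C \subset D -> cl C \subset D.
Proof.
move=> clD CD; rewrite /cl; elim: #|X| => //= n IH.
by apply: foldl_fire_closed => // i; rewrite mem_sigma.
Qed.

(** A round that changes the set adds an element. As long as stability is not reached, the set after
    n + 1 rounds has more than n elements, which is impossible for n = #|X|. *)
Lemma round_cl C : round (cl C) = cl C.
Proof.
suff stable n : (round (iter n round C) == iter n round C)
    || (n < #|round (iter n round C)|).
  have := stable #|X|; rewrite -/(cl C) => /orP[/eqP//|].
  by rewrite ltnNge max_card.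
elim: n => [|n /orP[/eqP IH|IH]] /=.
- have [//|neq] := eqVneq (round C) C; rewrite /= card_gt0.
  apply: contraNneq neq => r0; have := sub_round C.
  by rewrite r0 subset0 => /eqP->.
- by rewrite !IH eqxx.
- set D := round (iter n round C) in IH *.
  have [//|neq] := eqVneq (round D) D; apply: leq_ltn_trans IH _.
  by apply: proper_card; rewrite properEneq eq_sym neq sub_round.
Qed.

Lemma closed_cl C : closed_set Sigma (cl C).
Proof.
apply/closed_setP => A B AB.
apply: (@foldl_fire_fix sigma _ _ (A, B)); last by rewrite mem_sigma.
by rewrite -/(round _) round_cl.
Qed.

Lemma cl_closed C : closed_set Sigma C -> cl C = C.
Proof.
by move=> clC; apply/eqP; rewrite eqEsubset sub_cl cl_min.
Qed.

Lemma clS C (D : {set X}) : C \subset D -> cl C \subset cl D.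
Proof. by move=> CD; apply: cl_min (closed_cl D) (subset_trans CD (sub_cl D)). Qed.

Lemma sub_grow S C Z : C \subset grow S C Z.
Proof.
rewrite /grow; case: ifP => // _.
exact: subset_trans (subsetUl C Z) (sub_cl _).
Qed.

Lemma sub_extend Ls S C : C \subset extend Ls S C.
Proof.
rewrite /extend; elim: Ls C => //= Z Ls IH C.
exact: subset_trans (sub_grow S C Z) (IH _).
Qed.

Lemma extend_closed Ls S C : closed_set Sigma C -> ~~ (S \subset C) ->
  closed_set Sigma (extend Ls S C) && ~~ (S \subset extend Ls S C).
Proof.
rewrite /extend; elim: Ls C => [|Z Ls IH] C clC SC; first exact/andP.
apply: IH; rewrite /grow; case: ifP => // SZ; last exact/negbT.
exact: closed_cl.
Qed.

(** If [Z] was rejected, adding it already forced [S] into the closure; the set has only grown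
    since, so by monotonicity it still does. *)
Lemma extend_max Ls S C Z : Z \in Ls -> ~~ (Z \subset extend Ls S C) ->
  S \subset cl (extend Ls S C :|: Z).
Proof.
rewrite /extend; elim: Ls C => //= Z' Ls IH C.
rewrite inE => /predU1P[->|]; last exact: IH.
have := sub_extend Ls S (grow S C Z'); rewrite /extend.
move: (foldl _ _ _) => M; rewrite /grow; case: ifP => [SC CM _|_ CM].
  exact: subset_trans SC (clS (setSU _ CM)).
case/negP; apply: subset_trans CM; apply: subset_trans (sub_cl _).
exact: subsetUr.
Qed.

Lemma irrP x M :
  reflect [/\ closed_set Sigma M, x \notin M &
    forall D, closed_set Sigma D -> x \notin D -> M \subset D -> D = M]
    (M \in irr Sigma x).
Proof.
rewrite inE; apply: (iffP maxsetP) => [[/andP[clM xM] maxM]|[clM xM maxM]].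
  by split=> // D clD xD; apply: maxM; rewrite clD.
by split=> [|D /andP[clD xD]]; [rewrite clM | apply: maxM].
Qed.

(** A strictly larger closed set contains some z whose singleton was rejected, hence contains all of
    [S] and in particular [x]. *)
Lemma extend_irr Ls S C x : (forall z, [set z] \in Ls) ->
  closed_set Sigma C -> x \in S -> x \notin extend Ls S C ->
  ~~ (S \subset C) -> extend Ls S C \in irr Sigma x.
Proof.
move=> singL clC xS xM SC; have /andP[clM SM] := extend_closed Ls clC SC.
apply/irrP; split=> // D clD xD MD; apply/eqP.
rewrite eqEsubset MD andbT; apply/subsetP => z zD; apply: contraNT xD => zM.
have := @extend_max Ls S C [set z] (singL z); rewrite sub1set => /(_ zM) SMz.
apply: (subsetP (cl_min clD _)) (subsetP SMz _ xS).
by rewrite subUset MD sub1set.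
Qed.

Lemma extend_irr_closed Ls S C : (forall z, [set z] \in Ls) ->
  closed_set Sigma C -> ~~ (S \subset C) ->
  extend Ls S C \in irr_closed_sets Sigma.
Proof.
move=> singL clC SC; have /andP[_ /subsetPn[x xS xM]] := extend_closed Ls clC SC.
by apply/bigcupP; exists x => //; apply: extend_irr.
Qed.

(** * Ancestors, and closed sets one step closer to a target *)

Definition rank (x : X) : nat := #|[pred z | connect (arc Sigma) z x]|.

Lemma leq_rank u v : connect (arc Sigma) u v -> rank u <= rank v.
Proof.
by move=> uv; apply/subset_leq_card/subsetP => z; rewrite !inE => /connect_trans->.
Qed.

(** Ancestors of [u] are ancestors of [v], and [v] is counted for itself but not for [u]: a path
    from [v] to [u], shortened to a simple one, would close into a cycle along the arc. *)
Lemma ltn_rank u v : acyclic_base Sigma -> arc Sigma u v -> rank u < rank v.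
Proof.
move=> acyc uv; apply/proper_card/properP; split.
  apply/subsetP => z; rewrite !inE => /connect_trans->//; exact: connect1.
exists v; rewrite inE // ; apply/negP; rewrite /= => /connectP[p pth lst].
case/shortenP: pth lst => q pth uq _ lst.
suff: v :: q = [::] by [].
by apply: acyc; rewrite /ucycle /= rcons_path pth -lst uv.
Qed.

(** Adding to [M] all non-ancestors of [x] keeps it closed: if a conclusion is an ancestor of [x],
    so is its whole premise, which then lies in [M]. The enlarged set still avoids [x], so by
    maximality it is [M]. *)
Lemma irr_ancestor x M u : M \in irr Sigma x -> u \notin M ->
  connect (arc Sigma) u x.
Proof.
case/irrP=> /closed_setP clM xM maxM uM; apply: contraNT uM => ux.
pose D := M :|: [set z | ~~ connect (arc Sigma) z x].
suff <- : D = M by rewrite !inE ux orbT.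
apply: maxM; [|by rewrite !inE connect0 orbF|exact: subsetUl].
apply/closed_setP => A B AB AD; apply/subsetP => b bB; rewrite !inE.
have [//|bM /=] := boolP (b \in M); apply/negP => bx.
have /subsetPn[a aA aM] : ~~ (A \subset M).
  by apply: contra bM => /(clM _ _ AB)/subsetP->.
have := subsetP AD a aA; rewrite !inE (negbTE aM) => /negP; apply.
apply: connect_trans bx; apply/connect1/existsP.
by exists (A, B); rewrite AB aA.
Qed.

Lemma irr_above x C : closed_set Sigma C -> x \notin C ->
  exists2 M, M \in irr Sigma x & C \subset M.
Proof.
move=> clC xC.
have [|M maxM CM] := @maxset_exists X (fun C => closed_set Sigma C && (x \notin C)) C.
  by rewrite clC.
by exists M; rewrite ?inE.
Qed.

(** No edge A lies inside [Mx]: otherwise a conclusion outside [M] would belong to Mx \ M with rank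
    above that of [y]. So the vertices outside [Mx] form a transversal, and T is a minimal one among
    them. Each t in T has an arc to an element outside [M], which is an ancestor of [x]; this makes
    the rank of t strictly smaller. *)
Lemma premise_transversal x M (Mx : {set X}) y : acyclic_base Sigma ->
    M \in irr Sigma x -> Mx \in irr Sigma x -> y \in Mx :\: M ->
    (forall z, z \in Mx :\: M -> rank z <= rank y) ->
  exists T : {set X},
    [/\ T \in minimal_transversals (premise_hypergraph Sigma M y),
        forall t, t \in T -> t \notin Mx,
        forall t, t \in T -> rank t < rank x &
        forall A B, (A, B) \in Sigma -> A :\: M = [set y] -> ~~ (B \subset M) ->
          exists2 t, t \in T & t \in A].
Proof.
move=> acyc Mi Mxi yD ymax.
have arcAB A B a b : (A, B) \in Sigma -> a \in A -> b \in B -> arc Sigma a b.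
  by move=> AB aA bB; apply/existsP; exists (A, B); rewrite AB aA.
pose H := premise_hypergraph Sigma M y.
have hits : hits_all_edges H (vertices H :\: Mx).
  rewrite /hits_all_edges subsetDl; apply/forall_inP => A AE.
  have := AE; rewrite inE => /existsP[B /and3P[AB /eqP AM /subsetPn[b bB bM]]].
  have yA : y \in A by have := set11 y; rewrite -AM inE => /andP[].
  have bMx : b \notin Mx.
    apply/negP => bMx; have := ymax b; rewrite inE bM bMx => /(_ isT).
    by rewrite leqNgt (ltn_rank acyc (arcAB _ _ _ _ AB yA bB)).
  have [/closed_setP clMx _ _] := irrP _ _ Mxi.
  have /subsetPn[a aA aMx] : ~~ (A \subset Mx).
    by apply: contra bMx => /(clMx _ _ AB)/subsetP->.
  apply/set0Pn; exists a; rewrite !inE aMx aA /= andbT.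
  by apply/bigcupP; exists A.
have [T Tmin TM] := minset_exists hits.
have [/andP[Tv /forall_inP Thit] _] := minsetP Tmin.
exists T; split; first by rewrite inE.
- by move=> t /(subsetP TM); rewrite inE => /andP[].
- move=> t /(subsetP Tv)/bigcupP[A]; rewrite inE.
  move=> /existsP[B /and3P[AB _ /subsetPn[b bB bM]]] tA.
  apply: leq_trans (ltn_rank acyc (arcAB _ _ _ _ AB tA bB)) _.
  exact: leq_rank (irr_ancestor Mi bM).
- move=> A B AB AM BM; have AE : A \in edges H.
    by rewrite inE; apply/existsP; exists B; rewrite AB AM eqxx.
  by have /set0Pn[t] := Thit A AE; rewrite inE => /andP[tT tA]; exists t.
Qed.

(** A premise A inside the intersection whose conclusion is not inside [M] must meet the complement
    of [M] exactly in [y]. Then some t in [T] lies in A, although A is contained in [Mt t], which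
    avoids t. *)
Lemma step_closed M y (T : {set X}) (Mt : X -> {set X}) :
    closed_set Sigma M ->
    (forall t, t \in T -> Mt t \in irr Sigma t) ->
    (forall A B, (A, B) \in Sigma -> A :\: M = [set y] -> ~~ (B \subset M) ->
       exists2 t, t \in T & t \in A) ->
  closed_set Sigma ((M :|: [set y]) :&: \bigcap_(t in T) Mt t).
Proof.
move=> /closed_setP clM Mti hit; apply/closed_setP => A B AB.
rewrite subsetI => /andP[AMy /bigcapsP AMt].
have BMt t : t \in T -> B \subset Mt t.
  by move=> tT; have /irrP[/closed_setP clt _ _] := Mti t tT; apply: clt (AMt t tT).
rewrite subsetI; apply/andP; split; last exact/bigcapsP.
have [BM|BM] := boolP (B \subset M); first exact: subset_trans BM (subsetUl _ _).
have AM : A :\: M = [set y].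
  apply/eqP; rewrite eqEsubset subDset AMy sub1set inE.
  have /subsetPn[a aA aM] : ~~ (A \subset M) by apply: contra BM; apply: clM.
  have := subsetP AMy a aA; rewrite !inE (negbTE aM) /= => /eqP ay.
  by rewrite -ay aM aA.
have [t tT tA] := hit A B AB AM BM.
have /irrP[_ /negP[]] := Mti t tT; exact: subsetP (AMt t tT) t tA.
Qed.

End Closure.

(** * A saturated family contains all irreducible closed sets *)

Section Completeness.
Variables (X : finType) (Sigma : {set implication X}).
Variable sigma : seq (implication X).
Hypothesis sigmaP : perm_eq sigma (enum Sigma).
Variables (D : nat) (Ls F : seq {set X}).
Hypothesis acyc : acyclic_base Sigma.
Hypothesis bounded : forall x M y, M \in irr Sigma x -> y \notin M ->
  dual_dimension (premise_hypergraph Sigma M y) <= D.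
Hypothesis Ls_set1 : forall z, [set z] \in Ls.
Hypothesis Ls_set0 : set0 \in Ls.
Hypothesis Ls_setT : [set: X] \in Ls.
Hypothesis Ls_F : {subset F <= Ls}.

Definition capped (C : {set X}) (Ts : seq {set X}) : {set X} :=
  foldl (fun C T => C :&: T) C Ts.

(** This is what a pass without a find certifies. The number of intersected sets is exactly [D], the
    depth of the loop nest; shorter lists are padded with the full set, which has no effect. *)
Definition saturated : Prop := forall S0 S1 Ts S,
  S0 \in Ls -> S1 \in Ls -> size Ts = D -> {subset Ts <= Ls} -> S \in Ls ->
  ~~ (S \subset cl sigma (capped (S0 :|: S1) Ts)) ->
  extend sigma Ls S (cl sigma (capped (S0 :|: S1) Ts)) \in F.

Lemma capped_map (T : seq X) (Mt : X -> {set X}) C k :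
  capped C (map Mt T ++ nseq k [set: X]) = C :&: \bigcap_(t <- T) Mt t.
Proof.
rewrite /capped foldl_cat.
have capT A : foldl (fun C0 T0 => C0 :&: T0) A (nseq k [set: X]) = A.
  by elim: k A => //= k IH A; rewrite setIT IH.
rewrite capT; elim: T C => [|t T IH] C /=; first by rewrite big_nil setIT.
by rewrite IH big_cons setIA.
Qed.

Lemma saturated_complete : saturated -> {subset irr_closed_sets Sigma <= F}.
Proof.
move=> sat; suff all_irr x M : M \in irr Sigma x -> M \in F.
  by move=> M /bigcupP[x _]; apply: all_irr.
have [n] := ubnP (rank Sigma x); elim: n x M => // n IHn x Mx rank_x Mxi.
have [clMx xMx maxMx] := irrP _ _ _ Mxi.
have extF C : closed_set Sigma C -> x \notin C ->
    (exists S0 S1 Ts, [/\ S0 \in Ls, S1 \in Ls, size Ts = D, {subset Ts <= Ls} &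
       C = cl sigma (capped (S0 :|: S1) Ts)]) ->
    exists M', [/\ M' \in irr Sigma x, M' \in F & C \subset M'].
  move=> clC xC [S0 [S1 [Ts [L0 L1 szT LT CE]]]].
  have xC' : ~~ ([set x] \subset C) by rewrite sub1set.
  exists (extend sigma Ls [set x] C); split; last exact: sub_extend.
    apply: extend_irr => //; first exact: set11.
    by have /andP[_] := extend_closed sigmaP Ls clC xC'; rewrite sub1set.
  by rewrite CE in xC' *; apply: sat.
(* Any member of [irr x] already in [F] is a starting point for the walk to [Mx]; each step shrinks
   the part of [Mx] still missing. *)
have reach k M : M \in irr Sigma x -> M \in F -> #|Mx :\: M| < k -> Mx \in F.
  elim: k M => // k IHk M Mi MF leMk.
  have [clM xM maxM] := irrP _ _ _ Mi.
  have [sMx|] := boolP (Mx :\: M == set0).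
    by rewrite setD_eq0 in sMx; rewrite -(maxMx M clM xM sMx).
  case/set0Pn => y0 y0D; pose y := [arg max_(y > y0 in Mx :\: M) rank Sigma y].
  have [yD ymax] : y \in Mx :\: M /\
      forall z, z \in Mx :\: M -> rank Sigma z <= rank Sigma y.
    by rewrite /y; case: arg_maxnP => // i iD imax; split.
  have [T [Tmin TMx Trank Thit]] := premise_transversal acyc Mi Mxi yD ymax.
  have [yM yMx] : y \notin M /\ y \in Mx by move: yD; rewrite inE => /andP[].
  have Tsz : #|T| <= D.
    apply: leq_trans (bounded Mi yM); exact: (leq_bigmax_cond _ Tmin).
  (* The default is never taken on [T], since its elements lie outside the closed set [Mx]. *)
  pose Mt t := odflt set0 [pick M' in irr Sigma t | Mx \subset M'].
  have MtP t : t \in T -> Mt t \in irr Sigma t /\ Mx \subset Mt t.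
    move=> tT; rewrite /Mt; case: pickP => [M' /andP[]//|none].
    have [M' M'i sM'] := irr_above clMx (TMx t tT).
    by have := none M'; rewrite /= M'i sM'.
  have clC := step_closed clM (fun t tT => (MtP t tT).1) Thit.
  have [||M' [M'i M'F sM']] := extF _ clC.
  - rewrite !inE negb_and negb_or xM /=; apply/orP; left.
    by apply: contraNneq xMx => ->.
  (* The sets [Mt t] are in [F] by induction on the rank, and the intersection is already closed, so
     taking its closure changes nothing. *)
  - exists M, [set y], (map Mt (enum T) ++ nseq (D - #|T|) [set: X]); split.
    + exact: Ls_F.
    + exact: Ls_set1.
    + by rewrite size_cat size_map size_nseq -cardE subnKC.
    + move=> S; rewrite mem_cat => /orP[/mapP[t]|/nseqP[->]//].
      rewrite mem_enum => tT ->; apply/Ls_F/(IHn t); last by case: (MtP t tT).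
      exact: leq_trans (Trank t tT) rank_x.
    + by rewrite capped_map big_enum /= (cl_closed sigmaP).
  apply: (IHk M' M'i M'F); rewrite ltnS in leMk; apply: leq_trans leMk.
  apply: proper_card.
  (* Every [Mt t] contains [Mx], so the step loses nothing of [Mx] that was in [M], and it gains
     [y]. *)
  have sC : Mx :&: (M :|: [set y]) \subset M'.
    apply: subset_trans sM'; rewrite setIC setIS //.
    by apply/bigcapsP => t tT; case: (MtP t tT).
  apply/properP; split.
    apply/subsetP => z; rewrite !inE => /andP[zM' zMx]; rewrite zMx andbT.
    by apply: contra zM' => zM; apply: (subsetP sC); rewrite !inE zMx zM.
  exists y => //; rewrite inE negb_and negbK; apply/orP; left.
  by apply: (subsetP sC); rewrite !inE yMx eqxx orbT.
(* The walk starts at an extension of the closure of the empty set, which avoids [x] because it is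
   contained in [Mx]. *)
have [||M [Mi MF _]] := extF _ (closed_cl sigmaP set0).
- by apply: contra xMx; apply/subsetP/(cl_min sigmaP clMx); rewrite sub0set.
- exists set0, set0, (nseq D [set: X]); split=> //; first by rewrite size_nseq.
    by move=> S /nseqP[->].
  by rewrite (@capped_map [::] (fun=> set0)) big_nil setIT setU0.
exact: reach Mi MF (ltnSn _).
Qed.

End Completeness.

(** * The search for a new irreducible closed set *)

Local Notation "f ;; g" := (FComp f g) (at level 50, left associativity).

Definition f_true : fn := FPair FNil FNil.

(** Here and below, a fold over [GX] that ignores its items serves as a counter of #|X| iterations.
    Bits move from the front of one list to the front of an accumulator, which reverses them. *)
Definition f_rev : fn :=
  FPair FId FNil ;;
  FFold GX (FPair (FHd ;; FHd ;; FTl)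
                  (FPair (FHd ;; FHd ;; FHd) (FHd ;; FTl))) ;;
  FTl.

Definition f_zip (h : fn) : fn :=
  FPair FId FNil ;;
  FFold GX (FPair (FPair (FHd ;; FHd ;; FHd ;; FTl) (FHd ;; FHd ;; FTl ;; FTl))
                  (FPair (FPair (FHd ;; FHd ;; FHd ;; FHd)
                                (FHd ;; FHd ;; FTl ;; FHd) ;; h)
                         (FHd ;; FTl))) ;;
  FTl ;; f_rev.

Definition f_union : fn := f_zip (FIf FHd f_true FTl).

Definition f_inter : fn := f_zip (FIf FHd FTl FNil).

Definition f_subset : fn :=
  FPair FId f_true ;;
  FFold GX (FPair (FPair (FHd ;; FHd ;; FHd ;; FTl) (FHd ;; FHd ;; FTl ;; FTl))
                  (FIf (FHd ;; FHd ;; FHd ;; FHd)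
                       (FIf (FHd ;; FHd ;; FTl ;; FHd) (FHd ;; FTl) FNil)
                       (FHd ;; FTl))) ;;
  FTl.

(** Equality with a member of the list is tested as inclusion in both directions. *)
Definition f_mem : fn :=
  FPair FId FNil ;;
  FFold GF (FPair (FHd ;; FHd)
                  (FIf (FPair (FHd ;; FHd) FTl ;; f_subset)
                       (FIf (FPair FTl (FHd ;; FHd) ;; f_subset)
                            f_true (FHd ;; FTl))
                       (FHd ;; FTl))) ;;
  FTl.

Definition f_round : fn :=
  FFold GSigma (FIf (FPair (FTl ;; FHd) FHd ;; f_subset)
                    (FPair FHd (FTl ;; FTl) ;; f_union)
                    FHd).

Definition f_cl : fn := FFold GX (FHd ;; f_round).

Definition f_extend : fn :=
  FFold GL (FPair FHd (FPair (FHd ;; FTl) FTl ;; f_union ;; f_cl) ;;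
            FPair (FHd ;; FHd)
                  (FIf (FPair (FHd ;; FHd) FTl ;; f_subset) (FHd ;; FTl) FTl)) ;;
  FTl.

(* The input is Cons (Cons C S) r, where r is Nil or Cons M Nil with M the new *)
(* set found so far by the search.                                             *)
Definition f_try : fn :=
  FPair (FPair (FHd ;; FTl) (FHd ;; FHd ;; f_cl)) FTl ;;
  FIf (FHd ;; f_subset) FTl
      (FPair (FHd ;; f_extend) FTl ;;
       FIf (FHd ;; f_mem) FTl (FPair FHd FNil)).

(** One for-loop of the search: on [Cons a r], the body [b] runs for each S in the list, with a and
    S combined by [op], while the find r is threaded through all iterations. *)
Definition f_nest (op b : fn) : fn :=
  FFold GL (FPair (FHd ;; FHd)
                  (FPair (FPair (FHd ;; FHd) FTl ;; op) (FHd ;; FTl) ;; b)) ;;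
  FTl.

Definition f_caps (D : nat) : fn := iter D (f_nest f_inter) (f_nest FId f_try).

Definition f_pass (D : nat) : fn :=
  FPair FNil FNil ;; f_nest FTl (f_nest f_union (f_caps D)).

(* Maps a suffix of xs to the singleton of its first element: a suffix of     *)
(* length j is exhausted at step j, and as the bits are accumulated in reverse*)
(* the bit set at that step lands at position j from the end.                 *)
Definition f_set1 : fn :=
  FPair FId FNil ;;
  FFold GX (FPair (FHd ;; FHd ;; FTl)
                  (FPair (FIf (FHd ;; FHd ;; FTl) FNil
                              (FIf (FHd ;; FHd) f_true FNil))
                         (FHd ;; FTl))) ;;
  FTl.

(** The fold visits all nonempty suffixes of the listing and pushes one singleton for each. On the
    empty suffix [f_set1] never sets a bit, which supplies the encoding of the empty set. *)
Definition f_setup : fn :=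
  FPair (FGlob GX) (FPair (FGlob GX) (FPair (FNil ;; f_set1) FNil)) ;;
  FFold GX (FPair (FHd ;; FHd ;; FTl)
                  (FPair (FHd ;; FHd ;; f_set1) (FHd ;; FTl))) ;;
  FTl.

(** * Specifications of the programs on encoded sets *)

Lemma sem_comp G f g v : sem G (f ;; g) v = sem G g (sem G f v).
Proof. by []. Qed.

Lemma spine_encode_seq s : spine (encode_seq s) = s.
Proof. by elim: s => //= a s ->. Qed.

Lemma foldl_encode (T U : Type) (e : T -> tree) (e' : U -> tree)
    (step : tree -> tree -> tree) (op : T -> U -> T) (s : seq U) (a : T) :
  (forall a u, step (e a) (e' u) = e (op a u)) ->
  foldl step (e a) (map e' s) = e (foldl op a s).
Proof. by move=> stepE; elim: s a => //= u s IH a; rewrite stepE IH. Qed.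

Lemma is_cons_encode_bool b : is_cons (encode_bool b) = b.
Proof. by case: b. Qed.

Section Specifications.
Variables (X : finType) (Sigma : {set implication X}).
Variables (xs : seq X) (sigma : seq (implication X)).
Hypothesis xsP : perm_eq xs (enum X).
Hypothesis sigmaP : perm_eq sigma (enum Sigma).
Variable G : global -> tree.
Local Notation enc := (encode_set xs).
Hypothesis G_X : G GX = enc [set: X].
Hypothesis G_Sigma : G GSigma = encode_seq (map (encode_implication xs) sigma).
Implicit Types A B C S M : {set X}.

Lemma mem_xs x : x \in xs.
Proof. by rewrite (perm_mem xsP) mem_enum. Qed.

Lemma uniq_xs : uniq xs.
Proof. by rewrite (perm_uniq xsP) enum_uniq. Qed.

Lemma size_xs : size xs = #|X|.
Proof. by rewrite (perm_size xsP) -cardE. Qed.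

Lemma size_G_X : size (spine (G GX)) = size xs.
Proof. by rewrite G_X spine_encode_seq size_map. Qed.

Lemma sem_rev s : size s = size xs ->
  sem G f_rev (encode_seq s) = encode_seq (rev s).
Proof.
rewrite -size_G_X /f_rev /rev /= -[Nil]/(encode_seq [::]).
elim: s [::] (spine _) => [|a s IH] r [|i l] //= [sz].
exact: (IH (a :: r)).
Qed.

Lemma sem_zip h f g :
  sem G (f_zip h) (Cons (encode_seq (map f xs)) (encode_seq (map g xs))) =
  encode_seq (map (fun x => sem G h (Cons (f x) (g x))) xs).
Proof.
set hfg := fun x => _; have sz : size (map hfg xs) = size xs by rewrite size_map.
rewrite -[map hfg xs in RHS]revK -sem_rev ?size_rev //.
rewrite /f_zip sem_comp; congr (sem G f_rev _).
rewrite /rev; move/esym: size_G_X; rewrite /= -[Nil]/(encode_seq [::]).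
elim: xs [::] (spine _) => [|x s IH] r [|i l] //= [sz'].
exact: (IH (hfg x :: r)).
Qed.

Lemma sem_union A B : sem G f_union (Cons (enc A) (enc B)) = enc (A :|: B).
Proof.
rewrite sem_zip; congr encode_seq; apply: eq_map => x /=.
by rewrite is_cons_encode_bool inE; case: (x \in A).
Qed.

Lemma sem_inter A B : sem G f_inter (Cons (enc A) (enc B)) = enc (A :&: B).
Proof.
rewrite sem_zip; congr encode_seq; apply: eq_map => x /=.
by rewrite is_cons_encode_bool inE; case: (x \in A).
Qed.

Lemma sem_subset A B :
  sem G f_subset (Cons (enc A) (enc B)) = encode_bool (A \subset B).
Proof.
rewrite /f_subset /= -[Cons Nil Nil]/(encode_bool true) /encode_set.
have -> : (A \subset B) = true && all (fun x => (x \in A) ==> (x \in B)) xs.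
  apply/subsetP/allP => [AB x _|AB x xA]; first exact/implyP/AB.
  exact: (implyP (AB x (mem_xs x))).
move/esym: size_G_X.
elim: xs true (spine _) => [|x s IH] b [|i l] //=; first by rewrite andbT.
case=> sz; rewrite !is_cons_encode_bool.
case: (x \in A) (x \in B) => [] [] /=; rewrite ?(IH b) //.
by rewrite andbF (IH false).
Qed.

Opaque f_union f_inter f_subset.

Lemma sem_round C : sem G f_round (enc C) = enc (round sigma C).
Proof.
rewrite [LHS]/= G_Sigma spine_encode_seq.
apply: foldl_encode => {}C [A B] /=.
by rewrite sem_subset is_cons_encode_bool sem_union /fire /=; case: ifP.
Qed.

Opaque f_round.

Lemma sem_cl C : sem G f_cl (enc C) = enc (cl sigma C).
Proof.
rewrite /cl -size_xs -size_G_X /f_cl /=.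
by elim: (spine _) C => //= i l IH C; rewrite sem_round IH -iterSr.
Qed.

Opaque f_cl.

(** * Specification of the search *)

Section Search.
Variables Ls F : seq {set X}.
Hypothesis G_L : G GL = encode_seq (map enc Ls).
Hypothesis G_F : G GF = encode_seq (map enc F).

Lemma sem_mem M : sem G f_mem (enc M) = encode_bool (M \in F).
Proof.
pose op b S := b || (M == S).
have -> : (M \in F) = foldl op false F.
  rewrite -[LHS]/(false || _); elim: F false => [|S s IH] b /=.
    by rewrite orbF.
  by rewrite -IH inE orbA.
rewrite /f_mem [LHS]/= G_F spine_encode_seq -[Nil in LHS]/(encode_bool false).
rewrite (foldl_encode (e := fun b => Cons (enc M) (encode_bool b)) (op := op)) //.
move=> b S /=; rewrite !sem_subset !is_cons_encode_bool /op eqEsubset.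
by case: (M \subset S); case: (S \subset M); rewrite /= ?orbT ?orbF.
Qed.

Lemma sem_extend S C :
  sem G f_extend (Cons (enc S) (enc C)) = enc (extend sigma Ls S C).
Proof.
rewrite /f_extend [LHS]/= G_L spine_encode_seq.
rewrite (foldl_encode (e := fun D => Cons (enc S) (enc D)) (op := grow sigma S)) //.
move=> D Z /=; rewrite sem_union sem_cl sem_subset is_cons_encode_bool /grow.
by case: ifP.
Qed.

Opaque f_mem f_extend.

Definition found (r : tree) : Prop := r = Nil \/
  exists M, [/\ r = Cons (enc M) Nil, M \in irr_closed_sets Sigma & M \notin F].

(** The contract of a loop body: it keeps finds genuine, never discards one without having another,
    and if it ends without a find then [Q] holds. The middle clause lets the absence of a find at
    the end of a loop be carried back to each iteration. *)
Definition searches (T : Type) (e : T -> tree) (b : fn) (Q : T -> Prop) : Prop :=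
  forall a r, found r ->
    [/\ found (sem G b (Cons (e a) r)),
        is_cons r -> is_cons (sem G b (Cons (e a) r)) &
        sem G b (Cons (e a) r) = Nil -> Q a].

Lemma searches_try : (forall z, [set z] \in Ls) ->
  searches (fun CS => Cons (enc CS.1) (enc CS.2)) f_try
    (fun CS => ~~ (CS.2 \subset cl sigma CS.1) ->
       extend sigma Ls CS.2 (cl sigma CS.1) \in F).
Proof.
move=> singL [C S] r fr; rewrite /f_try /=.
rewrite sem_cl sem_subset is_cons_encode_bool.
case: ifP => [SC|/negbT SC]; first by split.
rewrite sem_extend sem_mem is_cons_encode_bool.
case: ifP => [MF|/negbT MF]; split=> //.
right; exists (extend sigma Ls S (cl sigma C)); split=> //.
by apply: (extend_irr_closed sigmaP singL (closed_cl sigmaP C) SC).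
Qed.

Lemma searches_nest (T U : Type) (e : T -> tree) (e' : U -> tree) op b opf Q :
  (forall a S, sem G op (Cons (e a) (enc S)) = e' (opf a S)) ->
  searches e' b Q ->
  searches e (f_nest op b) (fun a => forall S, S \in Ls -> Q (opf a S)).
Proof.
move=> opE sb a r fr; rewrite /f_nest /= G_L spine_encode_seq.
elim: Ls r fr => [|S s IH] r fr //=; rewrite opE.
have [fr' mono Qr] := sb (opf a S) r fr.
have [fr'' mono' Qr'] := IH _ fr'; split=> // [/mono/mono'//|r0 S'].
rewrite inE => /predU1P[->|]; last exact: Qr'.
(* The final result is [Nil] and later iterations never lose a find, so the result after this
   iteration was [Nil] as well. *)
by apply: Qr; move: mono' r0; case: (sem G b _) => // u v /(_ isT) + r0; rewrite r0.
Qed.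

Lemma searches_caps D : (forall z, [set z] \in Ls) ->
  searches enc (f_caps D) (fun C => forall Ts, size Ts = D -> {subset Ts <= Ls} ->
    forall S, S \in Ls -> ~~ (S \subset cl sigma (capped C Ts)) ->
    extend sigma Ls S (cl sigma (capped C Ts)) \in F).
Proof.
move=> singL; elim: D => [|D IH] C r fr.
  have [|fr' mono Qr] := @searches_nest _ _ enc _ FId f_try pair _ _
    (searches_try singL) C r fr; first by [].
  split=> // /Qr {}Qr [|//] _ _ S /Qr; exact.
have [|fr' mono Qr] := @searches_nest _ _ enc enc f_inter (f_caps D)
  (fun A B => A :&: B) _ _ IH C r fr; first exact: sem_inter.
split=> // /Qr {}Qr [//|T Ts] [szT] sTs; apply: Qr => //.
  by apply: sTs; rewrite mem_head.
by move=> T' T'Ts; apply: sTs; rewrite inE T'Ts orbT.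
Qed.

Opaque f_nest f_caps.

Lemma sem_pass D v : (forall z, [set z] \in Ls) ->
  found (sem G (f_pass D) v) /\
  (sem G (f_pass D) v = Nil -> saturated sigma D Ls F).
Proof.
move=> singL; rewrite /f_pass /=.
have sU := searches_nest (opf := fun A B => A :|: B) sem_union (searches_caps D singL).
(* The outermost loop starts from no set at all: its state is the unit, encoded by [Nil], and [FTl]
   just selects the current item as the first set. *)
have [||fr _ Qr] := @searches_nest _ _ (fun=> Nil) enc FTl _
  (fun (_ : unit) S => S) _ _ sU tt Nil; [by []|by left|].
by split=> // /Qr sat S0 S1 Ts S *; apply: sat.
Qed.

End Search.

(** * The initial list: singletons, the full set and the empty set *)

Lemma nseq_cons (T : Type) k (a : T) s : nseq k a ++ a :: s = a :: nseq k a ++ s.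
Proof. by elim: k => //= k ->. Qed.

Lemma foldl_set1 l q r : size q <= size l ->
  tl (foldl (fun a i => sem G (FPair (FHd ;; FHd ;; FTl)
                  (FPair (FIf (FHd ;; FHd ;; FTl) FNil
                              (FIf (FHd ;; FHd) f_true FNil))
                         (FHd ;; FTl))) (Cons a i))
    (Cons (encode_seq q) (encode_seq r)) l) =
  encode_seq (nseq (size l - size q) Nil ++
    (if q is _ :: q' then encode_bool true :: nseq (size q') Nil else [::]) ++ r).
Proof.
elim: l q r => [|i l IH] [|a [|b q]] r //= szq.
- by rewrite (IH [::] (Nil :: r)) //= !subn0 nseq_cons.
- by rewrite (IH [::] (encode_bool true :: r)) //= subn0 subn1.
- by rewrite (IH (b :: q) (Nil :: r)) //= -nseq_cons.
Qed.

Lemma sem_set1_nil : sem G f_set1 Nil = enc set0.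
Proof.
apply: etrans (@foldl_set1 (spine (G GX)) [::] [::] isT) _.
rewrite subn0 cats0 size_G_X; congr encode_seq.
by elim: xs => //= x s ->; rewrite inE.
Qed.

Lemma sem_set1 s1 x s2 (f : X -> tree) : xs = s1 ++ x :: s2 ->
  sem G f_set1 (encode_seq (map f (x :: s2))) = enc [set x].
Proof.
move=> xsE; have := uniq_xs; rewrite xsE cat_uniq /= negb_or.
case/and3P=> _ /andP[xs1 _] /andP[xs2 _].
apply: etrans (@foldl_set1 (spine (G GX)) (map f (x :: s2)) [::] _) _.
  by rewrite size_G_X xsE size_cat /= size_map leq_addl.
rewrite size_G_X /encode_set xsE size_cat /= size_map addnK cats0.
have nseqE s : x \notin s ->
    nseq (size s) Nil = [seq encode_bool (z \in [set x]) | z <- s].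
  elim: s => //= z s IH; rewrite inE negb_or eq_sym => /andP[zx /IH ->].
  by rewrite ?inE (negbTE zx).
by rewrite map_cat /= !nseqE // set11.
Qed.

Opaque f_set1.

Definition base_list : seq {set X} :=
  catrev [seq [set x] | x <- xs] [:: [set: X]; set0].

Lemma sem_setup v : sem G f_setup v = encode_seq (map enc base_list).
Proof.
rewrite /f_setup /= sem_set1_nil {1 2}G_X /base_list.
rewrite -[Cons _ (Cons _ Nil)]/(encode_seq (map enc [:: [set: X]; set0])).
move/esym: size_G_X; have := cat0s xs; rewrite {1}/encode_set.
(* Only the suffix still to be visited is generalised, along with the prefix [s1] already visited;
   the [xs] inside the encodings stays fixed and equals their concatenation. *)
elim: {1 3 4 7}xs [::] [:: _; _] (spine _) => [|x s IH] s1 acc [|i l] //= xsE [sz].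
rewrite (@sem_set1 s1 x s (fun z => encode_bool (z \in [set: X]))) //.
by apply: (IH (rcons s1 x) ([set x] :: acc)) => //; rewrite cat_rcons.
Qed.

End Specifications.

(** * The enumeration program *)

Definition record_cmd (k : nat) : cmd :=
  CAssign k (ECons (EHd (EVar 4)) (EVar k)).

Definition main_loop (D : nat) : cmd :=
  CWhile (EVar 4)
    (CSeq (COutput (EHd (EVar 4)))
    (CSeq (record_cmd 3) (CSeq (record_cmd 2) (compile 4 (f_pass D))))).

(** Register 0 holds the whole input at the start, so sigma is extracted before register 0 is
    overwritten. Register 3, the list of sets found, starts as [Nil]; register 4 carries the result
    of the latest pass. *)
Definition main_cmd (D : nat) : cmd :=
  CSeq (CAssign 1 (ETl (EVar 0)))
 (CSeq (CAssign 0 (EHd (EVar 0)))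
 (CSeq (compile 4 f_setup)
 (CSeq (CAssign 2 (EVar 4))
 (CSeq (compile 4 (f_pass D)) (main_loop D))))).

(** Bounds one iteration of the main loop: the test, the output of a tree of size at most 4 * #|X| +
    1, two list updates and the next pass. *)
Definition step_cost (D N : nat) : nat := 20 + 4 * N + cost (f_pass D) N.

Definition total_cost (D N : nat) : nat :=
  8 + cost f_setup N + cost (f_pass D) N + N.+1 * step_cost D N.

(** * Polynomial bounds *)

Definition polynomial (h : nat -> nat) : Prop :=
  exists p : {poly nat}, forall N, h N = p.[N]%R.

Lemma polynomial_const c : polynomial (fun=> c).
Proof. by exists (c%:P)%R => N; rewrite hornerC. Qed.

Lemma polynomial_id : polynomial id.
Proof. by exists 'X%R => N; rewrite hornerX. Qed.

Lemma polynomial_add h1 h2 : polynomial h1 -> polynomial h2 ->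
  polynomial (fun N => h1 N + h2 N).
Proof. by move=> [p1 E1] [p2 E2]; exists (p1 + p2)%R => N; rewrite hornerD E1 E2. Qed.

Lemma polynomial_mul h1 h2 : polynomial h1 -> polynomial h2 ->
  polynomial (fun N => h1 N * h2 N).
Proof. by move=> [p1 E1] [p2 E2]; exists (p1 * p2)%R => N; rewrite hornerM E1 E2. Qed.

Lemma polynomial_addn c h : polynomial h -> polynomial (fun N => c + h N).
Proof. by apply: polynomial_add; apply: polynomial_const. Qed.

(** Each fold multiplies by a linear factor, and the nesting of folds is fixed by the program. *)
Lemma polynomial_cost f : polynomial (cost f).
Proof.
elim: f => [|||| g | f1 IH1 f2 IH2 | f1 IH1 f2 IH2 | c IHc f1 IH1 f2 IH2 | g b IHb] /=;
  try exact: polynomial_const.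
- exact: polynomial_add.
- by apply: polynomial_add IH2; apply: polynomial_addn.
- by do 2![apply: polynomial_add => //]; apply: polynomial_addn.
- apply: polynomial_addn; apply: polynomial_mul; last exact: polynomial_addn.
  exact: (polynomial_addn 2 polynomial_id).
Qed.

Lemma polynomial_total_cost D : polynomial (total_cost D).
Proof.
apply: polynomial_add.
  apply: polynomial_add (polynomial_cost _).
  exact: (polynomial_addn 8 (polynomial_cost _)).
apply: polynomial_mul; first exact: (polynomial_addn 1 polynomial_id).
apply: polynomial_add (polynomial_cost _); apply: polynomial_addn.
exact: polynomial_mul (polynomial_const 4) polynomial_id.
Qed.

Lemma leq_step_cost D N N' : N <= N' -> step_cost D N <= step_cost D N'.
Proof.
by move=> le_N; have := leq_cost (f_pass D) le_N; rewrite /step_cost; lia.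
Qed.

Lemma tree_size_encode_set (X : finType) (xs : seq X) (A : {set X}) :
  tree_size (encode_set xs A) <= 4 * size xs + 1.
Proof.
rewrite /encode_set; elim: xs => //= x s IH.
by case: (x \in A) => /=; lia.
Qed.

(** * Correctness and running time of the enumeration *)

Section Main.
Variables (X : finType) (Sigma : {set implication X}) (D : nat).
Variables (xs : seq X) (sigma : seq (implication X)).
Hypothesis xsP : perm_eq xs (enum X).
Hypothesis sigmaP : perm_eq sigma (enum Sigma).
Hypothesis acyc : acyclic_base Sigma.
Hypothesis bounded : forall x M y, M \in irr Sigma x -> y \notin M ->
  dual_dimension (premise_hypergraph Sigma M y) <= D.
Local Notation enc := (encode_set xs).
Local Notation n := (#|X| + #|Sigma|).

Definition globals (Ls F : seq {set X}) (g : global) : tree :=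
  match g with
  | GX => enc [set: X]
  | GSigma => encode_seq (map (encode_implication xs) sigma)
  | GL => encode_seq (map enc Ls)
  | GF => encode_seq (map enc F)
  end.

Lemma size_globals Ls F N : #|X| <= N.+2 -> #|Sigma| <= N.+2 ->
  size Ls <= N.+2 -> size F <= N.+2 ->
  forall g, size (spine (globals Ls F g)) <= N.+2.
Proof.
move=> le_X le_Sigma le_Ls le_F []; rewrite spine_encode_seq size_map ?(size_xs xsP) //.
by rewrite (perm_size sigmaP) -cardE.
Qed.

Definition known (F : seq {set X}) : seq {set X} := F ++ base_list xs.

(** The full set and the empty set account for the [N.+2] in the length bounds on the globals. *)
Lemma size_known F : size (known F) = (size F + #|X|).+2.
Proof.
rewrite /known /base_list catrevE !size_cat size_rev size_map (size_xs xsP) /=.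
by rewrite !addnS addn0.
Qed.

Lemma known_set1 F z : [set z] \in known F.
Proof.
rewrite mem_cat /base_list catrevE !mem_cat mem_rev.
by rewrite (map_f (fun z => [set z])) ?orbT // (mem_xs xsP).
Qed.

Definition loop_inv (F : seq {set X}) (s : store) : Prop :=
  [/\ forall g, s (reg g) = globals (known F) F g,
      uniq F, {subset F <= irr_closed_sets Sigma},
      found Sigma xs F (s 4) & s 4 = Nil -> saturated sigma D (known F) F].

Lemma exec_pass F s N :
  (forall g, s (reg g) = globals (known F) F g) ->
  uniq F -> {subset F <= irr_closed_sets Sigma} -> n + size F <= N ->
  exists s' t, [/\ exec (compile 4 (f_pass D)) s s' t [::], loop_inv F s' &
    t <= cost (f_pass D) N].
Proof.
move=> sG uF sF le_N.
have szG : forall g, size (spine (globals (known F) F g)) <= N.+2.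
  by apply: size_globals; rewrite ?size_known; lia.
have [s' [t [ex s'4 s'j t_le]]] := compile_correct szG (f_pass D) (leqnn 4) sG.
have [fr sat] := @sem_pass X Sigma xs sigma xsP sigmaP (globals (known F) F)
  erefl erefl (known F) F erefl erefl D (s 4) (known_set1 F).
exists s', t; split=> //; split=> //; try by rewrite s'4.
by move=> g; rewrite s'j ?reg_lt.
Qed.

(** [k] exceeds the number of sets not yet found, so the induction on it proves termination. Output
    number j is preceded by j complete iterations, the dearest of which runs with at most j sets
    beyond [F]. *)
Lemma exec_main_loop k F s : loop_inv F s ->
  #|irr_closed_sets Sigma| < size F + k ->
  exists s' t o ms, [/\ exec (main_loop D) s s' t o,
    [seq q.2 | q <- o] = map enc ms,
    perm_eq (ms ++ F) (enum (irr_closed_sets Sigma)),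
    forall j, j < size o ->
      (nth (0, Nil) o j).1 <= j.+1 * step_cost D (n + size F + j) &
    t <= (size o).+1 * step_cost D (n + size F + size o)].
Proof.
have le_irr F' : uniq F' -> {subset F' <= irr_closed_sets Sigma} ->
    size F' <= #|irr_closed_sets Sigma|.
  by move=> uF' sF'; rewrite cardE uniq_leq_size // => M /sF'; rewrite mem_enum.
elim: k F s => [|k IH] F s [sG uF sF fr sat] lt_k.
  by rewrite addn0 ltnNge le_irr in lt_k.
have [s4|[M [s4 Mirr MF]]] := fr.
  exists s, 2, [::], [::]; split=> //.
    by apply: (@ExecWhileStop (EVar 4)); rewrite /= s4.
  apply: uniq_perm; rewrite ?enum_uniq // => M; rewrite mem_enum.
  apply/idP/idP; first exact: sF.
  apply: (saturated_complete sigmaP acyc bounded _ _ _ _ (sat s4)).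
  - exact: known_set1.
  - by rewrite mem_cat /base_list catrevE !mem_cat !inE eqxx !orbT.
  - by rewrite mem_cat /base_list catrevE !mem_cat !inE eqxx !orbT.
  - by move=> S SF; rewrite mem_cat SF.
pose s1 := update s 3 (Cons (enc M) (s 3)).
pose s2 := update s1 2 (Cons (enc M) (s1 2)).
have s2G g : s2 (reg g) = globals (known (M :: F)) (M :: F) g.
  have sG3 := sG GF; have sG2 := sG GL; have sG1 := sG GSigma; have sG0 := sG GX.
  by case: g; rewrite /s2 /s1 /update /= ?sG3 ?sG2 ?sG1 ?sG0.
have uMF : uniq (M :: F) by rewrite /= MF.
have sMF : {subset M :: F <= irr_closed_sets Sigma}.
  by move=> S; rewrite inE => /predU1P[->//|/sF].
have [s3 [t3 [ex3 inv3 t3_le]]] :=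
  exec_pass s2G uMF sMF (N := (n + size F).+1) ltac:(rewrite /=; lia).
have [|s' [t [o [ms [ex oE msP o_le t_le]]]]] := IH (M :: F) s3 inv3.
  by rewrite /= addSnnS.
pose tout := 2 + tree_size (enc M).
have exO : exec (COutput (EHd (EVar 4))) s s tout [:: (tout, enc M)].
  by have := ExecOutput s (EHd (EVar 4)); rewrite /= s4.
have exB : exec (CSeq (COutput (EHd (EVar 4)))
    (CSeq (record_cmd 3) (CSeq (record_cmd 2) (compile 4 (f_pass D))))) s s3
    (tout + (5 + (5 + t3))) [:: (tout, enc M)].
  refine (ExecSeq exO (o2 := [::]) _).
  apply: (exec_seq0 (s1 := s1)).
    by have := ExecAssign s 3 (ECons (EHd (EVar 4)) (EVar 3)); rewrite /= s4.
  apply: (exec_seq0 (s1 := s2)) ex3.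
  have s14 : s1 4 = Cons (enc M) Nil by rewrite /s1 update_other.
  by have := ExecAssign s1 2 (ECons (EHd (EVar 4)) (EVar 2)); rewrite /= s14.
have tout_le : tout <= 4 * #|X| + 3.
  by have := tree_size_encode_set xs M; rewrite (size_xs xsP) /tout; lia.
set N1 := (n + size F).+1 in t3_le.
have body_le : 2 + (tout + (5 + (5 + t3))) <= step_cost D N1.
  by rewrite /step_cost /N1; move: t3_le; rewrite /N1; lia.
(* After one iteration the family is longer by one and the output index smaller by one, so the bound
   for the remaining run is the original bound at the shifted index. *)
have NE i : n + size (M :: F) + i = n + size F + i.+1 by rewrite /= addnS addSn addnS.
have first_le : 2 + tout <= 1 * step_cost D (n + size F + 0).
  by rewrite mul1n /step_cost; lia.
exists s', (2 + (tout + (5 + (5 + t3))) + t),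
  ((2 + tout, enc M) :: delay (2 + (tout + (5 + (5 + t3)))) o), (M :: ms); split.
- refine (ExecWhileLoop (e := EVar 4) _ exB ex).
  by rewrite /= s4.
- by rewrite /= -oE -map_comp.
- by rewrite -(perm_catCA [:: M] ms F) in msP *; apply: msP.
- case=> [_|j]; first exact: first_le.
  rewrite [size _]/= ltnS /delay size_map => jo.
  rewrite [nth _ _ _]/= (nth_map (0, Nil)) // [_.1]/= mulSn -NE leq_add //.
    by rewrite (leq_trans body_le) // leq_step_cost // NE /N1 addnS ltnS leq_addr.
  exact: o_le.
- rewrite [size _]/= /delay size_map mulSn -NE leq_add //.
  by rewrite (leq_trans body_le) // leq_step_cost // NE /N1 addnS ltnS leq_addr.
Qed.

Lemma main_correct : exists s t o ms,
  [/\ exec (main_cmd D) (initial_store (encode_base xs sigma)) s t o,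
      [seq q.2 | q <- o] = [seq enc M | M <- ms],
      perm_eq ms (enum (irr_closed_sets Sigma)),
      forall i, i < size o -> (nth (0, Nil) o i).1 <= total_cost D (n + i.+1) &
      t <= total_cost D (n + size o)].
Proof.
set s0 := initial_store _.
pose s1 := update s0 1 (encode_seq (map (encode_implication xs) sigma)).
pose s2 := update s1 0 (enc [set: X]).
have s2G g : s2 (reg g) = globals [::] [::] g by case: g.
have szG : forall g, size (spine (globals [::] [::] g)) <= n.+2.
  by apply: size_globals => //=; lia.
have [s3 [t3 [ex3 s34 s3j t3_le]]] :=
  compile_correct szG f_setup (leqnn 4) s2G.
pose s4 := update s3 2 (s3 4).
have s4G g : s4 (reg g) = globals (known [::]) [::] g.
  case: g; rewrite /s4 /update /=.
  - exact: (s3j 0).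
  - exact: (s3j 1).
  - by rewrite s34 (sem_setup xsP).
  - exact: (s3j 3).
have [//|//||s5 [t5 [ex5 inv5 t5_le]]] := exec_pass s4G _ _ (N := n).
  by rewrite addn0.
have [s' [t [o [ms [ex oE msP o_le t_le]]]]] :=
  exec_main_loop inv5 (ltnSn #|irr_closed_sets Sigma|).
rewrite cats0 in msP; rewrite /= addn0 in o_le t_le.
pose t0 := 3 + (3 + (t3 + (2 + t5))).
have t0_le N : n <= N -> t0 <= 8 + cost f_setup N + cost (f_pass D) N.
  move=> le_N; have := leq_cost f_setup le_N; have := leq_cost (f_pass D) le_N.
  by rewrite /t0; lia.
exists s', (3 + (3 + (t3 + (2 + (t5 + t))))), (delay t0 o), ms; split=> //.
- have -> : delay t0 o = delay 3 (delay 3 (delay t3 (delay 2 (delay t5 o)))).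
    by rewrite /delay -!map_comp; apply: eq_map => q /=; rewrite /t0 !addnA.
  refine (ExecSeq (o1 := [::]) (s1 := s1) _ _).
    exact: (ExecAssign s0 1 (ETl (EVar 0))).
  refine (ExecSeq (o1 := [::]) (s1 := s2) _ _).
    exact: (ExecAssign s1 0 (EHd (EVar 0))).
  refine (ExecSeq (o1 := [::]) ex3 _).
  refine (ExecSeq (o1 := [::]) (s1 := s4) _ _).
    exact: (ExecAssign s3 2 (EVar 4)).
  exact: (ExecSeq (o1 := [::]) ex5 ex).
- by rewrite -oE /delay -map_comp.
- move=> i; rewrite size_map => io; rewrite (nth_map (0, Nil)) //=.
  apply: leq_add; first exact/t0_le/leq_addr.
  apply: leq_trans (o_le i io) _; rewrite leq_mul ?leq_step_cost ?leq_add2l //.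
  by rewrite ltnW // ltnS leq_addl.
- rewrite size_map; have -> : 3 + (3 + (t3 + (2 + (t5 + t)))) = t0 + t.
    by rewrite /t0; lia.
  apply: leq_add; first exact/t0_le/leq_addr.
  by apply: leq_trans t_le _; rewrite leq_mul // ltnS leq_addl.
Qed.

End Main.

Theorem theorem34 (d : int) :
  exists c : cmd,
    incremental_polynomial_ICS_enum c
      (fun X Sigma => acyclic_base Sigma /\ dual_dimension_bounded d Sigma).
Proof.
(* [d] is an integer and may be negative; the depth of the loop nest is a natural number that is at
   least [d]. *)
exists (main_cmd `|d|%N).
have [p pE] := polynomial_total_cost `|d|%N; exists p.
move=> X Sigma xs sigma _ [acyc bounded] xsP sigmaP.
have bounded' x M y : M \in irr Sigma x -> y \notin M ->
    dual_dimension (premise_hypergraph Sigma M y) <= `|d|%N.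
  by move=> Mi yM; have := bounded x M y Mi yM; lia.
have [s [t [o [ms [ex oE msP o_le t_le]]]]] := main_correct xsP sigmaP acyc bounded'.
by exists s, t, o, ms; split=> // [i io|]; rewrite -pE; [apply: o_le|].
Qed.
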